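(* Let $\mathcal V=\{V;\nu_1,\dots,\nu_n\}$ be a vector arrangement over $\Bbbk$ with $k=\dim V$ and associated hyperplane arrangement $\mathcal H$. The graded Euler characteristic of $H_\partial^{T\bullet}(\mathcal H)$ is $$\chi_q(H_\partial^{T\bullet}(\mathcal H))=(-x)^k\,\hat T\Bigl(\mathcal H;-\tfrac1x,\,-1-x-xy\Bigr).$$
   Context: Let $\Bbbk$ be a field of characteristic zero. A vector arrangement $\mathcal V=\{V;\nu_1,\dots,\nu_n\}$ is a finite-dimensional $\Bbbk$-vector space $V$ with an inner product together with a list of vectors $\nu_i\in V$ (zero allowed). The associated hyperplane arrangement is $\mathcal H=\{V;H_1,\dots,H_n\}$, $H_i=\nu_i^\perp$. For $S\subseteq[n]=\{1,\dots,n\}$ put $H_S=\bigcap_{s\in S}H_s$ ($H_\emptyset=V$), $W=\{w\in\Bbbk^n:\sum_iw_i\nu_i=0\}$ with the inner product induced from the standard one on $\Bbbk^n$, and $W_S=\{w\in W:w_r=0\text{ for }r\notin S\}$. The inner products are understood to restrict non-degenerately to all subspaces onto which orthogonal projections are taken. Tutte polynomial: $\hat T(\mathcal H;x,y)=\sum_{S\subseteq[n]}(-1)^{|S|}(1+x)^{\dim H_S}(1+y)^{\dim W_S}$. Chain complex $\mathcal C_\partial^T(\mathcal H)=\bigoplus_{S\subseteq[n]}\bigwedge^\bullet H_S\otimes\bigwedge^\bullet W_S$ with $\deg(\bigwedge^iH_S\otimes\bigwedge^jW_S)=(|S|+i,\,i,\,j)$ and differential $\partial^T=\bigoplus_{S,\,s\in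 S}w_{S,s}\otimes b_{S,s}$, where $w_{S,s}:\bigwedge^\bullet H_S\to\bigwedge^{\bullet+1}H_{S-s}$ is inclusion followed by left wedging with the orthogonal projection of $\nu_s$ to $H_{S-s}$, and $b_{S,s}:\bigwedge^\bullet W_S\to\bigwedge^\bullet W_{S-s}$ is induced by orthogonal projection. The differential has degree $(0,1,0)$; the second degree is homological. The homology is $H_\partial^{T\bullet}(\mathcal H)$. Graded Euler characteristic: $\chi_q(H_\partial^{T\bullet})=\sum_{a,i,j}(-1)^ix^ay^j\dim H_\partial^{T,(a,i,j)}$, where $(a,i,j)$ is the tridegree. *)

(* Defs.v *)
From HB Require Import structures.
From mathcomp Require Import all_boot all_order all_algebra.

Set Implicit Arguments.
Unset Strict Implicit.
Unset Printing Implicit Defensive.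

Import GRing.Theory passmx.
Local Open Scope ring_scope.

Section DirectSum.
Variables (K : fieldType) (I : finType) (A : I -> vectType K).

Definition dsum := {dffun forall i : I, (A i : eqType)}.

HB.instance Definition _ := Choice.copy dsum {dffun forall i, (A i : choiceType)}.

Implicit Types f g h : dsum.

Definition dsum_zero : dsum := [ffun i => (0 : A i)].
Definition dsum_opp f : dsum := [ffun i => (- f i : A i)].
Definition dsum_add f g : dsum := [ffun i => (f i + g i : A i)].
Definition dsum_scale (a : K) f : dsum := [ffun i => (a *: (f i : A i) : A i)].

Fact dsum_addA : associative dsum_add.
Proof. by move=> f g h; apply/ffunP=> i; rewrite !ffunE addrA. Qed.
Fact dsum_addC : commutative dsum_add.
Proof. by move=> f g; apply/ffunP=> i; rewrite !ffunE addrC. Qed.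
Fact dsum_add0 : left_id dsum_zero dsum_add.
Proof. by move=> f; apply/ffunP=> i; rewrite !ffunE add0r. Qed.
Fact dsum_addN : left_inverse dsum_zero dsum_opp dsum_add.
Proof. by move=> f; apply/ffunP=> i; rewrite !ffunE addNr. Qed.

HB.instance Definition _ :=
  GRing.isZmodule.Build dsum dsum_addA dsum_addC dsum_add0 dsum_addN.

Fact dsum_scaleA a b f : dsum_scale a (dsum_scale b f) = dsum_scale (a * b) f.
Proof. by apply/ffunP=> i; rewrite !ffunE scalerA. Qed.
Fact dsum_scale1 : left_id 1 dsum_scale.
Proof. by move=> f; apply/ffunP=> i; rewrite !ffunE scale1r. Qed.
Fact dsum_scaleDr : right_distributive dsum_scale +%R.
Proof. by move=> a f g; apply/ffunP=> i; rewrite !ffunE scalerDr. Qed.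
Fact dsum_scaleDl f : {morph dsum_scale^~ f : a b / a + b}.
Proof. by move=> a b; apply/ffunP=> i; rewrite !ffunE scalerDl. Qed.

HB.instance Definition _ := GRing.Zmodule_isLmodule.Build K dsum
  dsum_scaleA dsum_scale1 dsum_scaleDr dsum_scaleDl.

Fact dsum_vect_iso : Vector.axiom #|{: {i : I & 'I_(\dim {:A i})}}| dsum.
Proof.
pose J : finType := {i : I & 'I_(\dim {:A i})}.
pose fr f : 'rV[K]_#|J| := \row_k
  rVof (vbasis {:A (tag (enum_val k))}) (f (tag (enum_val k)) : A _)
    0 (tagged (enum_val k)).
pose rf (r : 'rV[K]_#|J|) : dsum := [ffun i => vecof (vbasis {:A i})
  (\row_j r 0 (enum_rank (Tagged (fun i => 'I_(\dim {:A i})) j : J))) : A i].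
exists fr.
  by move=> a f g; apply/rowP=> k; rewrite !mxE !ffunE linearP.
exists rf => [f|r].
  apply/ffunP=> i; rewrite ffunE; apply: (canLR (rVofK (vbasisP _))).
  by apply/rowP=> j; rewrite !mxE enum_rankK.
apply/rowP=> k; rewrite mxE ffunE (vecofK (vbasisP _)) mxE.
rewrite -[RHS](congr1 (r 0) (enum_valK k)).
by case: (enum_val k).
Qed.

HB.instance Definition _ := Lmodule_hasFinDim.Build K dsum dsum_vect_iso.

Definition dsum_in_fun i (a : A i) : dsum :=
  [ffun j => dfwith (fun k => 0 : A k) a j].
Definition dsum_out_fun i (f : dsum) : A i := f i.

Fact dsum_in_is_linear i : linear (@dsum_in_fun i).
Proof.
move=> a u v; apply/ffunP=> j; rewrite !ffunE.
case: (eqVneq i j) => [ij|ij]; last by rewrite !dfwith_out // scaler0 addr0.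
by case: j / ij; rewrite !dfwith_in.
Qed.
HB.instance Definition _ i := GRing.isLinear.Build K (A i) dsum _
  (@dsum_in_fun i) (@dsum_in_is_linear i).

Fact dsum_out_is_linear i : linear (@dsum_out_fun i).
Proof. by move=> a u v; rewrite /dsum_out_fun !ffunE. Qed.
HB.instance Definition _ i := GRing.isLinear.Build K dsum (A i) _
  (@dsum_out_fun i) (@dsum_out_is_linear i).

Definition dsum_in i : 'Hom(A i, dsum) := linfun (@dsum_in_fun i).
Definition dsum_out i : 'Hom(dsum, A i) := linfun (@dsum_out_fun i).

Definition dsum_sub (G : forall i, {vspace A i}) : {vspace dsum} :=
  (\bigcap_i (dsum_out i @^-1: G i))%VS.

Lemma mem_dsum_sub (G : forall i, {vspace A i}) f :
  reflect (forall i, (f i : A i) \in G i) (f \in dsum_sub G).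
Proof.
rewrite /dsum_sub memvE; apply: (iffP subv_bigcapP) => fG i => [|_].
  by have := fG i isT; rewrite -memvE -memv_preim lfunE.
by rewrite -memvE -memv_preim lfunE; apply: fG.
Qed.

End DirectSum.

Section Tensor.
Variable K : fieldType.

(* The matrix of coordinates in the basis (e_i (x) e'_j), where e and e' are  *)
(* the bases [vbasis {:A}] and [vbasis {:B}].                                *)
Definition tensor (A B : vectType K) := 'M[K]_(\dim {:A}, \dim {:B}).

HB.instance Definition _ A B := Vector.on (tensor A B).

Definition tmul (A B : vectType K) (a : A) (b : B) : tensor A B :=
  (rVof (vbasis {:A}) a)^T *m rVof (vbasis {:B}) b.

Definition tsub (A B : vectType K) (U : {vspace A}) (W : {vspace B}) :
  {vspace tensor A B} := <<[seq tmul a b | a <- vbasis U, b <- vbasis W]>>%VS.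

Section Map.
Variables (A B C D : vectType K) (f : 'Hom(A, C)) (g : 'Hom(B, D)).

Definition tmap_fun (t : tensor A B) : tensor C D :=
  (mxof (vbasis {:A}) (vbasis {:C}) f)^T *m (t : 'M__)
    *m mxof (vbasis {:B}) (vbasis {:D}) g.

Fact tmap_is_linear : linear tmap_fun.
Proof.
move=> a t u; rewrite /tmap_fun -!mulmxA.
by rewrite -[X in _ *m X]/(mulmxr _ _) !linearP.
Qed.
HB.instance Definition _ :=
  GRing.isLinear.Build K (tensor A B) (tensor C D) _ tmap_fun tmap_is_linear.

Definition tmap : 'Hom(tensor A B, tensor C D) := linfun tmap_fun.

Lemma tmapE a b : tmap (tmul a b) = tmul (f a) (g b).
Proof.
have mxofE (X Y : vectType K) (h : 'Hom(X, Y)) u :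
    rVof (vbasis {:X}) u *m mxof (vbasis {:X}) (vbasis {:Y}) h =
    rVof (vbasis {:Y}) (h u).
  by rewrite mul_rV_lin1 /= (rVofK (vbasisP _)).
by rewrite lfunE /= /tmap_fun /tmul -!mxofE trmx_mul !mulmxA.
Qed.

End Map.
End Tensor.

Section Exterior.
Variable K : fieldType.

(* [x : ext V] is the sum over [T] of [x T *: e_T], where                    *)
(* [e_T = e_t1 /\ ... /\ e_tp] for [T = {t1 < ... < tp}] and [e] is the basis *)
(* [vbasis {:V}] of [V].                                                     *)
Definition ext (V : vectType K) := {ffun {set 'I_(\dim {:V})} -> K^o}.

HB.instance Definition _ V := Vector.on (ext V).

Section Algebra.
Variable V : vectType K.
Local Notation d := (\dim {:V}).

Definition ext_basis (T : {set 'I_d}) : ext V :=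
  [ffun U : {set 'I_d} => (U == T)%:R].

Definition ext1 : ext V := ext_basis set0.

Definition extpow (i : nat) : {vspace ext V} :=
  <<[seq ext_basis T | T : {set 'I_d} in [pred T : {set 'I_d} | #|T| == i]]>>%VS.

Definition ext_in (v : V) : ext V :=
  \sum_(t < d) coord (vbasis {:V}) t v *: ext_basis [set t].

(* e_T /\ e_U = (-1)^{inversions T U} e_(T :|: U) for disjoint T and U. *)
Definition inversions (T U : {set 'I_d}) : nat :=
  #|[set p : 'I_d * 'I_d | [&& p.1 \in T, p.2 \in U & (p.2 < p.1)%N]]|.

Definition wedge (x y : ext V) : ext V :=
  [ffun S : {set 'I_d} => \sum_(T : {set 'I_d} | T \subset S)
     (-1) ^+ inversions T (S :\: T) * (x T : K) * (y (S :\: T) : K)].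

Fact wedge_is_linear x : linear (wedge x).
Proof.
move=> a y z; apply/ffunP=> S; rewrite !ffunE /= scaler_sumr -big_split /=.
apply: eq_bigr => T _; rewrite !ffunE mulrDr; congr (_ + _).
exact: mulrCA.
Qed.
HB.instance Definition _ x :=
  GRing.isLinear.Build K (ext V) (ext V) _ (wedge x) (wedge_is_linear x).

Definition lwedge (x : ext V) : 'End(ext V) := linfun (wedge x).

End Algebra.

Section Functoriality.
Variables (U V : vectType K) (f : 'Hom(U, V)).

(* e_t1 /\ ... /\ e_tp |-> f e_t1 /\ ... /\ f e_tp; the iterated product     *)
(* runs over [T] in increasing order.                                        *)
Definition ext_map_fun (x : ext U) : ext V :=
  \sum_(T : {set 'I_(\dim {:U})})
     x T *: \big[@wedge V/ext1 V]_(t in T) ext_in (f (vbasis {:U})`_t).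

Fact ext_map_is_linear : linear ext_map_fun.
Proof.
move=> a x y; rewrite /ext_map_fun scaler_sumr -big_split /=.
by apply: eq_bigr => T _; rewrite !ffunE scalerDl scalerA.
Qed.
HB.instance Definition _ :=
  GRing.isLinear.Build K (ext U) (ext V) _ ext_map_fun ext_map_is_linear.

Definition ext_map : 'Hom(ext U, ext V) := linfun ext_map_fun.

End Functoriality.
End Exterior.

Section Orthogonal.
Variables (K : fieldType) (V : vectType K) (ip : {symmetric V}).
Implicit Types U X Y : {vspace V}.

Definition nondegenerate_on (U : {vspace V}) : bool :=
  (U :&: orthov ip U == 0)%VS.

(* Meaningful when [nondegenerate_on U], i.e., when V = U (+) U^\perp.       *)
Definition orthoproj (U : {vspace V}) : 'End(V) := daddv_pi U (orthov ip U).

(* Meaningful when X is contained in Y: [vsproj Y] then only changes types.  *)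
Definition sub_incl (X Y : {vspace V}) : 'Hom(subvs_of X, subvs_of Y) :=
  linfun (vsproj Y \o vsval).

Definition sub_proj (X Y : {vspace V}) : 'Hom(subvs_of X, subvs_of Y) :=
  linfun (vsproj Y \o orthoproj Y \o vsval).

Lemma sub_inclE X Y u : (X <= Y)%VS -> vsval (sub_incl X Y u) = vsval u.
Proof.
by move=> /subvP sXY; rewrite lfunE /= vsprojK // sXY // subvsP.
Qed.

Lemma sub_projE X Y u : vsval (sub_proj X Y u) = orthoproj Y (vsval u).
Proof. by rewrite lfunE /= vsprojK ?memv_pi. Qed.

End Orthogonal.

Section StandardInnerProduct.
Variables (K : fieldType) (n : nat).

Definition std_ip (u v : 'rV[K]_n) : K := \sum_(i < n) u 0 i * v 0 i.

Fact std_ip_is_bilinear : bilinear_for *%R (idfun \; *%R) std_ip.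
Proof.
split=> [u|u] a v w /=; rewrite /std_ip /= mulr_sumr -big_split;
  apply: eq_bigr => i _; rewrite !mxE ?mulrDl ?mulrDr ?mulrA //.
by congr (_ + _); rewrite (mulrC _ a).
Qed.
HB.instance Definition _ := bilinear_isBilinear.Build K 'rV[K]_n 'rV[K]_n K
  *%R (idfun \; *%R) std_ip std_ip_is_bilinear.

Fact std_ip_sym u v : std_ip u v = (-1) ^+ false * idfun (std_ip v u).
Proof. by rewrite expr0 mul1r; apply: eq_bigr => i _; rewrite mulrC. Qed.
HB.instance Definition _ :=
  isHermitianSesquilinear.Build K 'rV[K]_n false idfun std_ip std_ip_sym.

End StandardInnerProduct.

Section Arrangement.
Variables (K : fieldType) (V : vectType K) (ip : {symmetric V}).
Variables (n : nat) (nu : 'I_n -> V).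
Implicit Types (S : {set 'I_n}) (s : 'I_n).

Definition hyperplane s : {vspace V} := orthov ip <[nu s]>.

Definition flat S : {vspace V} := (\bigcap_(s in S) hyperplane s)%VS.

Definition relation_fun (w : 'rV[K]_n) : V := \sum_(i < n) w 0 i *: nu i.

Fact relation_fun_is_linear : linear relation_fun.
Proof.
move=> a u v; rewrite /relation_fun scaler_sumr -big_split /=.
by apply: eq_bigr => i _; rewrite !mxE scalerDl scalerA.
Qed.
HB.instance Definition _ :=
  GRing.isLinear.Build K 'rV[K]_n V _ relation_fun relation_fun_is_linear.

Definition relations : {vspace 'rV[K]_n} := lker (linfun relation_fun).

Definition coord_fun (r : 'I_n) (w : 'rV[K]_n) : K^o := w 0 r.

Fact coord_fun_is_linear r : linear (coord_fun r).
Proof. by move=> a u v; rewrite /coord_fun !mxE. Qed.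
HB.instance Definition _ r :=
  GRing.isLinear.Build K 'rV[K]_n K^o _ (coord_fun r) (coord_fun_is_linear r).

Definition relations_on S : {vspace 'rV[K]_n} :=
  (relations :&: \bigcap_(r | r \notin S) lker (linfun (coord_fun r)))%VS.

Lemma mem_flat S (v : V) :
  reflect (forall s, s \in S -> ip v (nu s) = 0) (v \in flat S).
Proof.
rewrite /flat memvE; apply: (iffP subv_bigcapP) => vS s sS.
  by have := vS s sS; rewrite -memvE mem_orthov1 => /eqP.
by rewrite -memvE mem_orthov1 vS.
Qed.

Lemma mem_relations_on S (w : 'rV[K]_n) :
  reflect (\sum_i w 0 i *: nu i = 0 /\ forall r, r \notin S -> w 0 r = 0)
          (w \in relations_on S).
Proof.
rewrite memv_cap memv_ker lfunE /= -/(relation_fun w).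
rewrite [_ \in (\bigcap_(_ | _) _)%VS]memvE.
apply: (iffP andP) => [[/eqP w0 /subv_bigcapP wS]|[w0 wS]]; split=> //.
- by move=> r /wS; rewrite -memvE memv_ker lfunE => /eqP.
- exact/eqP.
apply/subv_bigcapP => r rS.
by rewrite -memvE memv_ker lfunE /= /coord_fun wS.
Qed.

(* Polynomials in x and y are represented by their values at arbitrary       *)
(* elements of arbitrary commutative rings.                                  *)
Definition tutte (R : comNzRingType) (x y : R) : R :=
  \sum_(S : {set 'I_n})
    (-1) ^+ #|S| * (1 + x) ^+ \dim (flat S) * (1 + y) ^+ \dim (relations_on S).

Definition summand S : vectType K :=
  tensor (ext (subvs_of (flat S))) (ext (subvs_of (relations_on S))).

Definition chains : vectType K := dsum summand.

Definition w_map S s :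
    'Hom(ext (subvs_of (flat S)), ext (subvs_of (flat (S :\ s)))) :=
  let F := flat (S :\ s) in
  (lwedge (ext_in (vsproj F (orthoproj ip F (nu s))))
     \o ext_map (sub_incl (flat S) F))%VF.

Definition b_map S s :
    'Hom(ext (subvs_of (relations_on S)),
         ext (subvs_of (relations_on (S :\ s)))) :=
  ext_map (sub_proj (@std_ip K n) (relations_on S) (relations_on (S :\ s))).

Definition differential : 'End(chains) :=
  \sum_(S : {set 'I_n}) \sum_(s in S)
    (dsum_in summand (S :\ s) \o tmap (w_map S s) (b_map S s)
       \o dsum_out summand S)%VF.

Definition chains_deg (a i j : nat) : {vspace chains} :=
  dsum_sub (fun S => if (#|S| + i == a)%N
    then tsub (extpow (subvs_of (flat S)) i)
              (extpow (subvs_of (relations_on S)) j)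
    else 0%VS).

Definition cycles (a i j : nat) : {vspace chains} :=
  (chains_deg a i j :&: lker differential)%VS.

Definition boundaries (a i j : nat) : {vspace chains} :=
  if i is i'.+1 then (differential @: chains_deg a i' j)%VS else 0%VS.

(* A complement of the boundaries in the cycles, as a model of the quotient  *)
(* of the cycles by the boundaries.                                          *)
Definition homology (a i j : nat) : {vspace chains} :=
  (cycles a i j :\: boundaries a i j)%VS.

(* All chains have tridegree (a, i, j) with a <= n + dim V, i <= dim V and   *)
(* j <= n.                                                                   *)
Definition euler_char (R : comNzRingType) (x y : R) : R :=
  \sum_(a < (n + \dim {:V}).+1) \sum_(i < (\dim {:V}).+1) \sum_(j < n.+1)
    (-1) ^+ i * x ^+ a * y ^+ j * (\dim (homology a i j))%:R.

End Arrangement.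

(* Main.v *)
Require Import Defs.
From HB Require Import structures.
From mathcomp Require Import all_boot all_order all_algebra.
From mathcomp Require Import ring.

Set Implicit Arguments.
Unset Strict Implicit.
Unset Printing Implicit Defensive.

Import GRing.Theory passmx.
Local Open Scope ring_scope.

(** The differential squares to zero and keeps the first and third degrees
    fixed, so for each [a] and [j] the chains of degrees [(a, i, j)] form a
    finite complex in [i], whose alternating sum of dimensions is that of its
    homology ([sum_telescope], [dim_homology]).  Counting the monomials of the
    summand of [S], where [h = dim H_S] and [w = dim W_S], gives
    [x ^ |S| (1 - x) ^ h (1 + y) ^ w] ([euler_char_flats]).  On the other side,
    [1 - 1/x = (1 - x) / (- x)] and [1 + (-1 - x - x y) = (- x) (1 + y)], so that
    the term of [S] is
    [(-1) ^ |S| (- x) ^ (k - h + w) (1 - x) ^ h (1 + y) ^ w], where [k = dim V].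
    The two agree because [h + |S| = k + w] ([dim_flat_relations]), which is
    rank-nullity for [z |-> \sum_s z_s nu_s] on the vectors supported in [S],
    together with [H_S] being the orthogonal of the image.

    That the differential squares to zero ([differential_sq]) is where the
    geometry enters.  Let [F = H_(S - s - t)] and let [a], [b] be the projections
    of [nu_s], [nu_t] to [F].  Since [H_(S - s)] is the orthogonal of [b] in [F],
    the projection of [nu_s] to [H_(S - s)] is [a + c b] for some scalar [c]
    ([orthoproj_hyperplane]).  Removing [s] and then [t] from [S] therefore acts
    on the flat factor as left wedging with [b /\ (a + c b) = b /\ a], and
    removing [t] and then [s] as left wedging with [a /\ b].  The other tensor
    factor is the same for both orders, because successive orthogonal
    projections to nested subspaces compose ([orthoproj_nested]).  So the two
    orders cancel.  This uses that exterior powers are functorial and compatible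
    with left wedging by vectors ([ext_map_comp], [ext_map_wedge]).  The latter
    rests on the anticommutation of these wedgings ([wedge_in_anti]) and on
    writing each basis element [e_T] as a product of them. *)

(** * Left wedging by vectors in the exterior algebra *)

(** In the presence of 2-torsion, antisymmetry does not make the diagonal vanish;
    hence the two hypotheses. *)
Lemma sum_alternating (I : Type) (r : seq I) (P : pred I) (M : zmodType)
    (F : I -> I -> M) :
    (forall i, P i -> F i i = 0) ->
    (forall i j, P i -> P j -> F i j = - F j i) ->
  \sum_(i <- r | P i) \sum_(j <- r | P j) F i j = 0.
Proof.
move=> Fii Fij; elim: r => [|x r IHr]; first by rewrite big_nil.
rewrite !big_cons; case: ifP => Px; last first.
  by rewrite -[RHS]IHr; apply: eq_bigr => i _; rewrite big_cons Px.
rewrite Px Fii // add0r.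
under [X in _ + X]eq_bigr => i Pi do rewrite big_cons Px (Fij i x Pi Px).
by rewrite big_split /= IHr addr0 sumrN subrr.
Qed.

(** Exterior coefficients live in [K^o], where scaling hides the product of [K]
    from rewriting. *)
Lemma scale_regE (K : fieldType) (a b : K) : a *: (b : K^o) = a * b.
Proof. by []. Qed.

Section ExteriorAlgebra.
Variables (K : fieldType) (V : vectType K).
Local Notation d := (\dim {:V}).
Implicit Types (x : ext V) (v w : V) (S T : {set 'I_d}) (t u : 'I_d).

(** The number of transpositions that bring [e_t] into place in [e_t /\ e_S]. *)
Definition below S t : nat := #|[set u in S | (u < t)%N]|.

Lemma inversions1 t S : inversions [set t] (S :\ t) = below S t.
Proof.
rewrite /inversions /below -[RHS]mul1n -(cards1 t) -cardsX.
apply: eq_card => -[a b]; rewrite !inE /=.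
case: (a =P t) => //= ->.
by case: (b =P t) => [->|] //=; rewrite ltnn andbF.
Qed.

Lemma wedge_inE v x S :
  wedge (ext_in v) x S =
  \sum_(t in S) (-1) ^+ below S t * coord (vbasis {:V}) t v * x (S :\ t).
Proof.
rewrite ffunE /ext_in.
under eq_bigr => T _.
  rewrite sum_ffunE mulr_sumr mulr_suml.
  under eq_bigr => t _ do rewrite !ffunE.
  over.
rewrite exchange_big /= [RHS]big_mkcond; apply: eq_bigr => t _.
case: ifPn => [tS|tS].
  rewrite (bigD1 [set t]) ?sub1set //= eqxx inversions1 big1 ?addr0 => [|T].
    by rewrite [_ *: _]mulr1.
  by move=> /andP[_ /negPf->]; rewrite scaler0 mulr0 mul0r.
rewrite big1 // => T TS.
case: eqP => [eT|_]; last by rewrite scaler0 mulr0 mul0r.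
by move: TS; rewrite eT sub1set (negPf tS).
Qed.

Lemma belowD1 S t u :
  t \in S -> below S u = ((t < u) + below (S :\ t) u)%N.
Proof.
move=> tS; rewrite /below.
have -> : [set s in S :\ t | (s < u)%N] = [set s in S | (s < u)%N] :\ t.
  by apply/setP=> s; rewrite !inE andbA.
by rewrite [LHS](cardsD1 t) inE tS.
Qed.

(** The coefficient at [S] is a sum over ordered pairs [t], [u] of elements of
    [S]: extracting [t] then [u] or [u] then [t] leaves the same set, and the
    signs differ by one transposition. *)
Lemma wedge_in_sq v x : wedge (ext_in v) (wedge (ext_in v) x) = 0.
Proof.
apply/ffunP => S; rewrite wedge_inE [RHS]ffunE.
pose c t := coord (vbasis {:V}) t v.
(* The boolean [t < u] is the transposition by which the two orders differ. *)
pose F t u : K := if t == u then 0 else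
  (-1) ^+ (below S t + below S u + (t < u)) * (c t * c u) * x (S :\ t :\ u).
transitivity (\sum_(t in S) \sum_(u in S) F t u).
  apply: eq_bigr => t tS; rewrite wedge_inE mulr_sumr.
  rewrite [RHS](bigD1 t) //= {1}/F eqxx add0r.
  apply: eq_big => [u|u]; first by rewrite !inE andbC.
  rewrite !inE => /andP[/negPf ut uS]; rewrite /F eq_sym ut (belowD1 u tS).
  have -> (b : bool) m p :
      (-1) ^+ (m + (b + p) + b) = (-1) ^+ m * (-1) ^+ p :> K.
    case: b; rewrite !exprD ?expr1 ?expr0 ?mulN1r ?mul1r ?mulr1 ?mulrN;
      by rewrite ?mulr1 ?opprK.
  by rewrite !mulrA; congr (_ * _); rewrite -!mulrA (mulrCA (c t)).
apply: sum_alternating => [t _|t u _ _]; first by rewrite /F eqxx.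
rewrite /F eq_sym; case: (eqVneq u t) => [_|ut]; first by rewrite oppr0.
rewrite -!mulNr; congr (_ * _); last by congr (x _); rewrite !setDDl setUC.
rewrite [c t * _]mulrC; congr (_ * _).
rewrite (addnC (below S t)) !exprD -mulrN.
congr (_ * _); case: ltngtP => [||/val_inj e]; rewrite ?opprK //.
by rewrite e eqxx in ut.
Qed.

Lemma coord_basis t u : coord (vbasis {:V}) t (vbasis {:V})`_u = (u == t)%:R.
Proof. exact/coord_free/basis_free/vbasisP. Qed.

Lemma wedge_in_basis t T :
  wedge (ext_in (vbasis {:V})`_t) (ext_basis T) =
  if t \in T then 0 else (-1) ^+ below T t *: ext_basis (t |: T).
Proof.
apply/ffunP=> S; rewrite wedge_inE.
under eq_bigr => u _ do rewrite coord_basis ffunE.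
have [tS|tS] := boolP (t \in S); last first.
  rewrite big1 => [|u uS]; last first.
    by case: eqP => [e|]; [rewrite e uS in tS | rewrite mulr0 mul0r].
  case: ifP => _; rewrite !ffunE //.
  case: eqP => [e|_]; last by rewrite scaler0.
  by rewrite e setU11 in tS.
rewrite (bigD1 t) //= eqxx mulr1 big1 ?addr0; last first.
  by move=> u /andP[_ /negPf]; rewrite eq_sym => ->; rewrite mulr0 mul0r.
have [tT|tT] := ifPn.
  by case: eqP => [e|_]; [rewrite -e !inE eqxx in tT | rewrite mulr0 ffunE].
rewrite !ffunE scale_regE.
have -> : (S :\ t == T) = (S == t |: T).
  by apply/eqP/eqP => [<-|->]; rewrite ?setD1K ?setU1K.
case: eqP => [->|_] /=; last by rewrite !mulr0.
by rewrite (belowD1 t (setU11 t T)) ltnn add0n setU1K.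
Qed.

Lemma ext_in_is_linear : linear (@ext_in K V).
Proof.
move=> a v w; rewrite /ext_in scaler_sumr -big_split; apply: eq_bigr => t _ /=.
by rewrite linearP scalerDl scalerA.
Qed.
HB.instance Definition _ :=
  GRing.isLinear.Build K V (ext V) _ (@ext_in K V) ext_in_is_linear.

Lemma wedgeDl x y z : wedge (x + y) z = wedge x z + wedge y z :> ext V.
Proof.
apply/ffunP=> S; rewrite !ffunE -big_split; apply: eq_bigr => T _ /=.
by rewrite ffunE mulrDr mulrDl.
Qed.

Lemma wedgeZl a x z : wedge (a *: x) z = a *: wedge x z :> ext V.
Proof.
apply/ffunP=> S; rewrite !ffunE scaler_sumr; apply: eq_bigr => T _ /=.
by rewrite ffunE !scale_regE -!mulrA; rewrite [RHS]mulrCA.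
Qed.

Lemma wedge_in_anti v w x :
  wedge (ext_in v) (wedge (ext_in w) x) =
  - wedge (ext_in w) (wedge (ext_in v) x).
Proof.
apply/eqP; rewrite -addr_eq0; apply/eqP.
have := wedge_in_sq (v + w) x.
by rewrite !linearD /= !wedgeDl !linearD /= !wedge_in_sq add0r addr0.
Qed.

Lemma ext_expand x : x = \sum_T x T *: ext_basis T.
Proof.
apply/ffunP=> S; rewrite sum_ffunE (bigD1 S) //= !ffunE eqxx big1 ?addr0.
  by rewrite [RHS]mulr1.
by move=> T /negPf ST; rewrite !ffunE eq_sym ST scaler0.
Qed.

Lemma enum_min t (T : {set 'I_d}) :
  (forall u, u \in T -> (t < u)%N) -> enum (t |: T) = t :: enum T.
Proof.
move=> ltT; have sorted_enum (A : {set 'I_d}) : sorted ltn (map val (enum A)).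
  rewrite (subseq_sorted ltn_trans (s2 := map val (enum 'I_d))) //.
    apply/map_subseq; rewrite [enum 'I_d]enumT; exact: filter_subseq.
  by rewrite val_enum_ord iota_ltn_sorted.
apply: (inj_map val_inj); apply: (irr_sorted_eq ltn_trans ltnn) => //=.
  rewrite path_min_sorted //; apply/allP => _ /mapP[u uT ->].
  by apply: ltT; rewrite mem_enum in uT.
move=> k; rewrite inE; apply/mapP/idP => [[u]|].
  rewrite mem_enum in_setU1 => /orP[/eqP->->|uT ->]; rewrite ?eqxx //.
  by rewrite map_f ?orbT ?mem_enum.
case/predU1P=> [->|/mapP[u]]; first by exists t; rewrite ?mem_enum ?setU11.
by rewrite mem_enum => uT ->; exists u; rewrite // mem_enum setU1r.
Qed.

Lemma below_min t T : (forall u, u \in T -> (t < u)%N) -> below T t = 0%N.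
Proof.
move=> ltT; apply/eqP; rewrite cards_eq0; apply/eqP/setP => u; rewrite !inE.
by apply/negP=> /andP[/ltT tu ut]; have := ltn_trans tu ut; rewrite ltnn.
Qed.

(** Building a set by adding smaller and smaller elements builds [e_T] by left
    wedging without signs. *)
Lemma set_min_ind (P : {set 'I_d} -> Prop) :
    P set0 ->
    (forall t T, (forall u, u \in T -> (t < u)%N) -> P T -> P (t |: T)) ->
  forall T, P T.
Proof.
move=> P0 PU T; have [m] := ubnP #|T|; elim: m T => // m IHm T leTm.
have [->//|[t0 t0T]] := set_0Vmem T.
case: (arg_minnP (fun t : 'I_d => val t) t0T) => t tT0 tmin.
have {tT0} tT : t \in T := tT0.
rewrite -(setD1K tT); apply: PU => [u|].
  rewrite !inE => /andP[ut uT]; rewrite ltn_neqAle tmin // andbT eq_sym.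
  by apply: contra ut => /eqP/val_inj->.
by apply: IHm; rewrite (cardsD1 t T) tT in leTm.
Qed.

End ExteriorAlgebra.

(** * Functoriality and grading of the exterior algebra *)

Section Functoriality.
Variables (K : fieldType) (U V : vectType K) (f : 'Hom(U, V)).
Local Notation d := (\dim {:U}).

Lemma ext_map_basis (T : {set 'I_d}) :
  ext_map f (ext_basis T) =
  \big[@wedge K V/ext1 V]_(t in T) ext_in (f (vbasis {:U})`_t).
Proof.
rewrite lfunE /= /ext_map_fun (bigD1 T) //= ffunE eqxx scale1r big1 ?addr0 //.
by move=> S /negPf ST; rewrite ffunE ST scale0r.
Qed.

Lemma ext_map1 : ext_map f (ext1 U) = ext1 V.
Proof. by rewrite ext_map_basis big_set0. Qed.

Lemma ext_map_basis_min (t : 'I_d) (T : {set 'I_d}) :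
    (forall u, u \in T -> (t < u)%N) ->
  ext_map f (ext_basis (t |: T)) =
  wedge (ext_in (f (vbasis {:U})`_t)) (ext_map f (ext_basis T)).
Proof.
move=> ltT; rewrite !ext_map_basis -![bigop _ (index_enum _) _]big_filter.
by rewrite [index_enum _]unlock -!/(enum _) enum_min // big_cons.
Qed.

(** By definition of the induced map, this holds when [t] is smaller than all of
    [T].  Otherwise let [s] be the minimum of [T]: if [s = t], both sides vanish;
    if [s < t], wedging by [e_s] and [e_t] can be exchanged on both sides, and
    the claim for [t] and the smaller set [T - s] applies. *)
Lemma ext_map_wedge_basis (t : 'I_d) (T : {set 'I_d}) :
  ext_map f (wedge (ext_in (vbasis {:U})`_t) (ext_basis T)) =
  wedge (ext_in (f (vbasis {:U})`_t)) (ext_map f (ext_basis T)).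
Proof.
elim/set_min_ind: T t => [|s T ltT IHT] t.
  rewrite wedge_in_basis inE below_min ?scale1r ?ext_map_basis_min //;
    by move=> u; rewrite inE.
have es : ext_basis (s |: T) = wedge (ext_in (vbasis {:U})`_s) (ext_basis T).
  rewrite wedge_in_basis below_min // scale1r; case: ifP => // /ltT.
  by rewrite ltnn.
have fes := ext_map_basis_min ltT.
case: (ltngtP t s) => [ts|st|/val_inj->].
- have ltT' (u : 'I_d) : u \in s |: T -> (t < u)%N.
    by rewrite in_setU1 => /predU1P[->|/ltT/(ltn_trans ts)].
  rewrite wedge_in_basis below_min // scale1r.
  case: ifP => [/ltT'|_]; first by rewrite ltnn.
  by rewrite (ext_map_basis_min ltT').
- rewrite fes [RHS]wedge_in_anti -IHT es wedge_in_anti linearN; congr (- _).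
  rewrite wedge_in_basis; case: ifPn => [_|tT]; first by rewrite !linear0.
  rewrite !linearZ /=; congr (_ *: _).
  have ltT' (u : 'I_d) : u \in t |: T -> (s < u)%N.
    by rewrite in_setU1 => /predU1P[->|/ltT].
  rewrite wedge_in_basis below_min // scale1r.
  case: ifP => [/ltT'|_]; first by rewrite ltnn.
  by rewrite (ext_map_basis_min ltT').
- by rewrite fes wedge_in_sq es !wedge_in_sq linear0.
Qed.

Lemma ext_map_wedge (u : U) (x : ext U) :
  ext_map f (wedge (ext_in u) x) = wedge (ext_in (f u)) (ext_map f x).
Proof.
rewrite (coord_vbasis (memvf u)) !linear_sum /=.
have suml I (r : seq I) (W : vectType K) (y : I -> ext W) z :
    wedge (\sum_(i <- r) y i) z = \sum_(i <- r) wedge (y i) z.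
  elim: r => [|i r IHr]; last by rewrite !big_cons wedgeDl IHr.
  by rewrite !big_nil; have := wedgeZl 0 (0 : ext W) z; rewrite !scale0r.
rewrite !suml linear_sum; apply: eq_bigr => t _ /=.
rewrite !linearZ /= !wedgeZl linearZ /=; congr (_ *: _).
rewrite (ext_expand x) !linear_sum; apply: eq_bigr => T _.
by rewrite !linearZ /= ext_map_wedge_basis.
Qed.

End Functoriality.

Lemma ext_map_comp (K : fieldType) (U V W : vectType K)
    (f : 'Hom(U, V)) (g : 'Hom(V, W)) :
  (ext_map g \o ext_map f)%VF = ext_map (g \o f).
Proof.
apply/lfunP=> x; rewrite comp_lfunE (ext_expand x) !linear_sum.
apply: eq_bigr => T _; rewrite !linearZ /=; congr (_ *: _).
elim/set_min_ind: T => [|t T ltT IHT]; first by rewrite -/(ext1 U) !ext_map1.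
by rewrite !ext_map_basis_min // ext_map_wedge IHT comp_lfunE.
Qed.

Section Grading.
Variables (K : fieldType).

Lemma mem_extpow (V : vectType K) i (x : ext V) :
  reflect (forall T : {set 'I_(\dim {:V})}, #|T| != i -> x T = 0)
          (x \in extpow V i).
Proof.
apply: (iffP idP) => [/coord_span-> T Ti|xi].
  rewrite sum_ffunE big1 // => k _; rewrite !ffunE.
  set y := nth _ _ _; have /imageP[S /eqP Si ->] :
      y \in [seq ext_basis T | T : {set 'I_(\dim {:V})}
                              in [pred T : {set _} | #|T| == i]].
    by rewrite mem_nth // size_image.
  rewrite ffunE; case: eqP => [e|_]; last by rewrite scaler0.
  by rewrite e Si eqxx in Ti.
rewrite (ext_expand x); apply: memv_suml => T _.
have [Ti|/xi->] := eqVneq #|T| i; last by rewrite scale0r mem0v.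
by apply/memvZ/memv_span/image_f; rewrite inE Ti.
Qed.

Lemma dim_extpow (V : vectType K) i : \dim (extpow V i) = 'C(\dim {:V}, i).
Proof.
pose P := [pred A : {set 'I_(\dim {:V})} | #|A| == i].
rewrite -[\dim {:V} in RHS]card_ord -card_draws cardE.
rewrite -(size_map (@ext_basis K V)).
have -> : enum [set A : {set 'I_(\dim {:V})} | #|A| == i] = enum P.
  by apply: eq_enum => A; rewrite !inE.
have UP : uniq (enum P) by apply: enum_uniq.
suff : free [seq ext_basis T | T <- enum P] by move/eqP.
elim: (enum P) UP => [|T s IHs] /=; first by rewrite nil_free.
move=> /andP[Ts /IHs fs]; rewrite free_cons fs andbT.
apply/negP=> Tin; have /(congr1 (fun x : ext V => x T)) :=
  coord_span (X := in_tuple [seq ext_basis U | U <- s]) Tin.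
rewrite ffunE eqxx sum_ffunE big1 => [/eqP|k _]; first by rewrite oner_eq0.
have := mem_nth 0 (ltn_ord k); rewrite ffunE.
move=> /mapP[S Ss ->]; rewrite ffunE.
case: eqP => [e|_]; last by rewrite scaler0.
by rewrite e Ss in Ts.
Qed.

Lemma wedge_in_extpow (V : vectType K) (v : V) i (x : ext V) :
  x \in extpow V i -> wedge (ext_in v) x \in extpow V i.+1.
Proof.
move=> /mem_extpow xi; apply/mem_extpow => T Ti.
rewrite wedge_inE big1 // => t tT.
by rewrite xi ?mulr0 //; apply: contra Ti; rewrite (cardsD1 t T) tT => /eqP->.
Qed.

Lemma ext_map_extpow (U V : vectType K) (f : 'Hom(U, V)) i :
  (ext_map f @: extpow U i <= extpow V i)%VS.
Proof.
rewrite limg_span; apply/span_subvP => _ /mapP[_ /imageP[T /eqP<- ->] ->].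
elim/set_min_ind: T => [|t T ltT IHT].
  rewrite cards0 ext_map1; apply/mem_extpow => T; rewrite cards_eq0 ffunE.
  by move=> /negPf->.
rewrite ext_map_basis_min // cardsU1; case: (t \in T) (ltT t) => [/(_ isT)|_].
  by rewrite ltnn.
exact: wedge_in_extpow.
Qed.

End Grading.

(** * Tensor products and direct sums of subspaces *)

Section Tensor.
Variable K : fieldType.
Implicit Types A B C D : vectType K.

Lemma tmap_comp A B C D A' B' (f : 'Hom(A, C)) (g : 'Hom(B, D))
    (f' : 'Hom(A', A)) (g' : 'Hom(B', B)) :
  (tmap f g \o tmap f' g')%VF = tmap (f \o f') (g \o g').
Proof.
apply/lfunP=> t; rewrite comp_lfunE !lfunE /= /tmap_fun.
by rewrite !(mxof_comp _ _ (vbasisP _)) trmx_mul !mulmxA.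
Qed.

Lemma tmapNl A B C D (f : 'Hom(A, C)) (g : 'Hom(B, D)) :
  tmap (- f) g = - tmap f g.
Proof.
apply/lfunP=> t; rewrite opp_lfunE !lfunE /= /tmap_fun.
by rewrite !linearN /= !mulNmx.
Qed.

Lemma limg_tmap A B C D (f : 'Hom(A, C)) (g : 'Hom(B, D))
    (U : {vspace A}) (W : {vspace B}) (U' : {vspace C}) (W' : {vspace D}) :
    (f @: U <= U')%VS -> (g @: W <= W')%VS ->
  (tmap f g @: tsub U W <= tsub U' W')%VS.
Proof.
move=> fU gW; rewrite limg_span.
apply/span_subvP => _ /mapP[_ /allpairsP[[a b] /= [aU bW ->]] ->].
rewrite tmapE.
have := subvP fU _ (memv_img f (vbasis_mem aU)).
have := subvP gW _ (memv_img g (vbasis_mem bW)).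
move: (f a) (g b) => c e /coord_vbasis-> /coord_vbasis->.
rewrite /tmul !linear_sum /=; apply: memv_suml => j _.
rewrite mulmx_suml; apply: memv_suml => i _.
rewrite !linearZ /= -scalemxAl; do 2!apply: memvZ.
by apply/memv_span/allpairs_f; rewrite mem_nth ?size_tuple.
Qed.

(** Let the rows of [P] and [Q] be the coordinates of the bases of [U] and [W].
    Both matrices have full row rank, so [M |-> P^T M Q] is injective, and it
    maps the matrix units to the generators of [tsub U W]. *)
Lemma dim_tsub A B (U : {vspace A}) (W : {vspace B}) :
  \dim (tsub U W) = (\dim U * \dim W)%N.
Proof.
pose cmx X (Y : {vspace X}) : 'M[K]_(\dim Y, \dim {:X}) :=
  \matrix_i rVof (vbasis {:X}) (vbasis Y)`_i.
have cmx_free X (Y : {vspace X}) : row_free (cmx X Y).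
  apply/inj_row_free => v v0; apply/rowP=> i; rewrite mxE.
  have /freeP fY := basis_free (vbasisP Y).
  apply: (fY (fun i => v 0 i)).
  apply/eqP; rewrite -(rVof_eq0 (vbasisP {:X})) -v0 linear_sum mulmx_sum_row.
  by apply/eqP/eq_bigr => j _; rewrite linearZ rowK.
pose h (M : 'M[K]_(\dim U, \dim W)) : tensor A B :=
  (cmx A U)^T *m M *m cmx B W.
have h_lin : linear h.
  by move=> c M N; rewrite /h mulmxDr mulmxDl -scalemxAr -scalemxAl.
pose H := GRing.isLinear.Build K _ _ _ h h_lin.
pose hL : {linear _ -> _} := HB.pack h H.
have h_inj : lker (linfun hL) == 0%VS.
  apply/lker0P => M N; rewrite !lfunE /= /h => /(row_free_inj (cmx_free _ _)).
  move=> /(congr1 trmx); rewrite !trmx_mul !trmxK.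
  by move=> /(row_free_inj (cmx_free _ _))/trmx_inj.
have hE i j : h (delta_mx i j) = tmul (vbasis U)`_i (vbasis W)`_j.
  rewrite /h -(mul_delta_mx (0 : 'I_1)) mulmxA -mulmxA.
  by rewrite -colE -rowE -tr_row !rowK.
rewrite -[RHS](_ : \dim {: 'M[K]_(\dim U, \dim W)} = _); last by rewrite dimvf.
rewrite -(limg_dim_eq (f := linfun hL)) ?(eqP h_inj) ?capv0 //.
congr (\dim _); apply: subv_anti; apply/andP; split.
  apply/span_subvP => _ /allpairsP[[a b] /= [/tnthP[i ->] /tnthP[j ->] ->]].
  by rewrite !(tnth_nth 0) -hE -[h _]/(hL _) -lfunE memv_img ?memvf.
apply/subvP=> _ /memv_imgP[M _ ->].
rewrite lfunE [M]matrix_sum_delta !linear_sum.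
apply: memv_suml => i _; rewrite linear_sum; apply: memv_suml => j _.
rewrite linearZ memvZ //= hE; apply/memv_span/allpairs_f.
  by rewrite mem_nth ?size_tuple.
by rewrite mem_nth ?size_tuple.
Qed.

End Tensor.

Section DirectSum.
Variables (K : fieldType) (I : finType) (A : I -> vectType K).

Lemma dsum_in_outE (i j : I) (a : A i) :
  dsum_out A j (dsum_in A i a) = dfwith (fun k => 0 : A k) a j.
Proof. by rewrite !lfunE /= /dsum_out_fun ffunE. Qed.

Lemma dsum_inK i : (dsum_out A i \o dsum_in A i)%VF = \1%VF.
Proof.
by apply/lfunP=> a; rewrite comp_lfunE dsum_in_outE dfwith_in id_lfunE.
Qed.

Lemma dsum_in_out_neq i j : i != j -> (dsum_out A j \o dsum_in A i)%VF = 0.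
Proof.
move=> ij; apply/lfunP=> a.
by rewrite comp_lfunE dsum_in_outE dfwith_out // zero_lfunE.
Qed.

Lemma dsum_expand (f : dsum A) : f = \sum_i dsum_in A i (dsum_out A i f).
Proof.
have outE g j : dsum_out A j g = g j by rewrite lfunE.
apply/ffunP=> j; rewrite -!outE linear_sum (bigD1 j) //=.
rewrite dsum_in_outE dfwith_in big1 ?addr0 // => i ij.
by rewrite dsum_in_outE dfwith_out.
Qed.

Lemma dsum_in_sub (G : forall i, {vspace A i}) i (a : A i) :
  a \in G i -> dsum_in A i a \in dsum_sub G.
Proof.
move=> aG; apply/mem_dsum_sub => j; rewrite lfunE ffunE.
have [<-|ij] := eqVneq i j; first by rewrite dfwith_in.
by rewrite dfwith_out // mem0v.
Qed.

Lemma dim_dsum_sub (G : forall i, {vspace A i}) :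
  \dim (dsum_sub G) = (\sum_i \dim (G i))%N.
Proof.
have inj i : (G i :&: lker (dsum_in A i) = 0)%VS.
  apply/eqP; rewrite -subv0; apply/subvP=> a /memv_capP[_].
  rewrite memv_ker => /eqP a0; have := congr1 (dsum_out A i) a0.
  by rewrite -comp_lfunE dsum_inK id_lfunE linear0 memv0 => ->.
have -> : dsum_sub G = (\sum_i dsum_in A i @: G i)%VS.
  apply: subv_anti; apply/andP; split.
    apply/subvP=> f /mem_dsum_sub fG; rewrite (dsum_expand f).
    apply: memv_suml => i _.
    apply/(subvP (sumv_sup i _ (subvv _)))/memv_img => //.
    by rewrite lfunE.
  apply/subv_sumP => i _; apply/subvP => _ /memv_imgP[a aG ->].
  exact: dsum_in_sub.
have /directvP -> : directv (\sum_i dsum_in A i @: G i)%VS.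
  apply/directv_sum_independent => us usG us0 i _.
  have /memv_imgP[a _ ea] := usG i isT.
  have := congr1 (dsum_out A i) us0.
  rewrite linear_sum (bigD1 i) //= big1 => [|j ji].
    rewrite ea addr0 -comp_lfunE dsum_inK id_lfunE linear0 => ->.
    by rewrite linear0.
  have /memv_imgP[b _ ->] := usG j isT.
  by rewrite -comp_lfunE dsum_in_out_neq // zero_lfunE.
by apply: eq_bigr => i _; apply: limg_dim_eq.
Qed.

End DirectSum.

(** * Orthogonal projections *)

Section Orthogonality.
Variables (K : fieldType) (V : vectType K) (ip : {symmetric V}).
Implicit Types (U X Y : {vspace V}) (u v : V).

Lemma ip_sym u v : ip u v = ip v u.
Proof. by rewrite hermC expr0 mul1r. Qed.

Lemma nondegenerateP U :
  reflect (forall u, u \in U -> {in U, forall v, ip u v = 0} -> u = 0)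
          (nondegenerate_on ip U).
Proof.
apply: (iffP eqP) => [U0 u uU uv|ndU].
  by apply/eqP; rewrite -memv0 -U0 memv_cap uU; apply/mem_orthovP.
apply/eqP; rewrite -subv0; apply/subvP => u /memv_capP[uU /mem_orthovP uv].
by rewrite memv0; apply/eqP/ndU.
Qed.

(** Each vector of a basis of [X] imposes one linear condition on [U]. *)
Lemma dim_cap_orthov_geq U X : (\dim U <= \dim (U :&: orthov ip X) + \dim X)%N.
Proof.
suff leU (s : seq V) : (\dim U <= \dim (U :&: orthov ip <<s>>) + size s)%N.
  by have := leU (vbasis X); rewrite size_tuple (span_basis (vbasisP X)).
elim: s U => [|x s IHs] U; first by rewrite span_nil orthov0 capvf addn0.
have -> : orthov ip <<x :: s>> = (orthov ip <[x]> :&: orthov ip <<s>>)%VS.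
  apply/vspaceP => v; rewrite memv_cap span_cons.
  by rewrite !mem_orthov_sym subv_add.
rewrite capvA addnS; apply: leq_trans (leqSpred _) _; rewrite ltnS.
exact: leq_trans (leq_dim_orthov1 ip x U) (IHs _).
Qed.

Lemma addv_orthov U : nondegenerate_on ip U -> (U + orthov ip U)%VS = fullv.
Proof.
move=> /eqP ndU; apply/eqP; rewrite eqEdim subvf dimv_disjoint_sum //=.
by have := dim_cap_orthov_geq fullv U; rewrite capfv addnC.
Qed.

(** For the upper bound, take a complement [Y] of the orthogonal of [X]: a vector
    of [X] that is orthogonal to [Y] is orthogonal to everything, hence zero, so
    [dim X <= dim Y]. *)
Lemma dim_orthov X : nondegenerate_on ip fullv ->
  (\dim (orthov ip X) + \dim X)%N = \dim {:V}.
Proof.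
move=> /nondegenerateP nd; apply/eqP; rewrite eqn_leq.
have := dim_cap_orthov_geq fullv X; rewrite capfv => ->; rewrite andbT.
have : (\dim X <= \dim (orthov ip X)^C)%N.
  have := dim_cap_orthov_geq X (orthov ip X)^C.
  rewrite (_ : (X :&: _)%VS = 0%VS) ?dimv0 //.
  apply/eqP; rewrite -subv0; apply/subvP => u /memv_capP[uX /mem_orthovP uC].
  rewrite memv0; apply/eqP/nd; rewrite ?memvf // => v _.
  have /memv_addP[w /mem_orthovP wX [z zC ->]] :
      v \in (orthov ip X + (orthov ip X)^C)%VS.
    by rewrite addv_complf memvf.
  by rewrite linearDr /= (uC z zC) addr0 ip_sym; apply: wX.
by rewrite dimv_compl leq_subRL ?dimvS ?subvf.
Qed.

Lemma mem_orthoproj U u : orthoproj ip U u \in U.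
Proof. exact: memv_pi. Qed.

Lemma orthoproj_ip U u v :
  nondegenerate_on ip U -> v \in U -> ip (orthoproj ip U u) v = ip u v.
Proof.
move=> ndU vU; have := daddv_pi_add (eqP ndU) (_ : u \in _).
rewrite addv_orthov // memvf => /(_ isT) eu; rewrite -[in RHS]eu linearDl /=.
by have /mem_orthovP -> := memv_pi (orthov ip U) U u; rewrite ?addr0.
Qed.

Lemma orthoproj_uniq U u w : nondegenerate_on ip U -> w \in U ->
  {in U, forall v, ip w v = ip u v} -> orthoproj ip U u = w.
Proof.
move=> ndU wU wu; apply/eqP; rewrite -subr_eq0; apply/eqP.
apply: (nondegenerateP _ ndU); first by rewrite memvB ?mem_orthoproj.
by move=> v vU; rewrite linearBl /= orthoproj_ip // wu ?subrr.
Qed.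

Lemma orthoproj_nested X Y u : nondegenerate_on ip X -> nondegenerate_on ip Y ->
  (Y <= X)%VS -> orthoproj ip Y (orthoproj ip X u) = orthoproj ip Y u.
Proof.
move=> ndX ndY /subvP YX; apply: orthoproj_uniq => // [|v vY].
  exact: mem_orthoproj.
by rewrite !orthoproj_ip // YX.
Qed.

(** Inside [U], the vectors orthogonal to [X] form the line of the projection [b']
    of [b], so projecting further from [U] to [X] adds a multiple of [b'].  If
    [b'] is isotropic, it lies in [X] and is orthogonal to it, hence zero, and
    [X = U]; otherwise the scalar is the usual Gram-Schmidt coefficient. *)
Lemma orthoproj_hyperplane U X (b u : V) :
    nondegenerate_on ip U -> nondegenerate_on ip X ->
    X = (U :&: orthov ip <[b]>)%VS ->
  exists c, orthoproj ip X u = orthoproj ip U u + c *: orthoproj ip U b.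
Proof.
move=> ndU ndX eX; set b' := orthoproj ip U b.
have b'U : b' \in U by apply: mem_orthoproj.
have memX v : (v \in X) = (v \in U) && (ip b' v == 0).
  rewrite eX memv_cap mem_orthov1 (ip_sym v b).
  by case: (boolP (v \in U)) => //= vU; rewrite /b' orthoproj_ip.
have [b'0|b'n0] := eqVneq (ip b' b') 0.
  have b'00 : b' = 0.
    apply: (nondegenerateP _ ndX) => [|v]; rewrite memX ?b'U ?b'0 ?eqxx //.
    by case/andP=> _ /eqP.
  exists 0; rewrite scale0r addr0; congr (orthoproj ip _ u).
  by apply/vspaceP=> v; rewrite memX b'00 linear0l eqxx andbT.
exists (- (ip u b' / ip b' b')); apply: orthoproj_uniq => //.
  rewrite memX memvD ?memvZ ?mem_orthoproj //= linearDr linearZr /=.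
  by rewrite ip_sym orthoproj_ip // mulNr divfK ?subrr.
move=> v; rewrite memX => /andP[vU /eqP b'v].
by rewrite linearDl linearZl_LR /= b'v mulr0 addr0 orthoproj_ip.
Qed.

End Orthogonality.

(** * The differential squares to zero *)

Section Complex.
Variables (K : fieldType) (V : vectType K) (ip : {symmetric V}).
Variables (n : nat) (nu : 'I_n -> V).
Implicit Types (S X : {set 'I_n}) (s t : 'I_n).
Local Notation H := (flat ip nu).
Local Notation W := (relations_on nu).

Lemma flatS S X : X \subset S -> (H S <= H X)%VS.
Proof.
move=> /subsetP XS; apply/subvP => v /mem_flat vS.
by apply/mem_flat => s /XS/vS.
Qed.

Lemma flatU1 t X : H (t |: X) = (H X :&: orthov ip <[nu t]>)%VS.
Proof.
apply/vspaceP=> v; rewrite memv_cap mem_orthov1.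
apply/mem_flat/andP => [vtX|[/mem_flat vX /eqP vt] s].
  rewrite vtX ?setU11; split=> //.
  by apply/mem_flat => s sX; rewrite vtX ?setU1r.
by rewrite in_setU1 => /predU1P[->|/vX].
Qed.

Lemma relations_onS S X : X \subset S -> (W X <= W S)%VS.
Proof.
move=> /subsetP XS; apply/subvP => w /mem_relations_on[w0 wX].
apply/mem_relations_on; split=> // r rS.
by apply: wX; apply: contra rS; apply: XS.
Qed.

(** The component of the differential that removes [s].  The target set [X] is a
    parameter, so that [S - s - t] and [S - t - s], which are equal but not
    convertible, can serve as the same target. *)
Definition arrow S X s : 'Hom(summand ip nu S, summand ip nu X) :=
  tmap (lwedge (ext_in (vsproj (H X) (orthoproj ip (H X) (nu s))))
          \o ext_map (sub_incl (H S) (H X)))%VF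
       (ext_map (sub_proj (@std_ip K n) (W S) (W X))).

Lemma differentialE :
  differential ip nu = \sum_(S : {set 'I_n}) \sum_(s in S)
    (dsum_in _ (S :\ s) \o arrow S (S :\ s) s \o dsum_out _ S)%VF.
Proof. by []. Qed.

Hypothesis flat_nd : forall (S : {set 'I_n}) (s : 'I_n),
  s \in S -> nondegenerate_on ip (H (S :\ s)).
Hypothesis relations_nd : forall (S : {set 'I_n}) (s : 'I_n),
  s \in S -> nondegenerate_on (@std_ip K n) (W (S :\ s)).

(** The projection of [nu_s] to [H_(S - s)] may be replaced by that to the larger
    flat [F]: the two differ by a multiple of the projection of [nu_t],
    which the second wedge kills. *)
Lemma arrow_comp (S : {set 'I_n}) (s t : 'I_n) : s \in S -> t \in S -> s != t ->
  let F := H (S :\ s :\ t) in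
  let e v := lwedge (ext_in (vsproj F (orthoproj ip F v))) in
  (arrow (S :\ s) (S :\ s :\ t) t \o arrow S (S :\ s) s)%VF =
  tmap (e (nu t) \o e (nu s) \o ext_map (sub_incl (H S) F))%VF
       (ext_map (sub_proj (@std_ip K n) (W S) (W (S :\ s :\ t)))).
Proof.
move=> sS tS st F e; set A := S :\ s; set X := A :\ t.
have tA : t \in A by rewrite !inE eq_sym st.
have ndA := flat_nd sS; have ndX := flat_nd tA.
have eA : A = t |: X by rewrite setD1K.
have XA : X \subset A := subsetDl _ _.
have AS : A \subset S := subsetDl _ _.
have eHA : H A = (H X :&: orthov ip <[nu t]>)%VS by rewrite -flatU1 -eA.
rewrite /arrow tmap_comp ext_map_comp; congr (tmap _ (ext_map _)); last first.
  apply/lfunP=> w; apply: subvs_inj; rewrite comp_lfunE !sub_projE.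
  apply: orthoproj_nested; [exact: relations_nd sS | exact: relations_nd tA |].
  exact: relations_onS.
have incl_comp :
    (sub_incl (H A) F \o sub_incl (H S) (H A))%VF = sub_incl (H S) F.
  apply/lfunP=> w; apply: subvs_inj.
  by rewrite comp_lfunE !sub_inclE // flatS // (subset_trans XA).
apply/lfunP=> z; rewrite !comp_lfunE ![lwedge _ _]lfunE /= ext_map_wedge.
rewrite -[ext_map _ (ext_map _ z)]comp_lfunE ext_map_comp incl_comp.
have [c ec] := orthoproj_hyperplane (nu s) ndX ndA eHA.
have -> : sub_incl (H A) F (vsproj (H A) (orthoproj ip (H A) (nu s))) =
    vsproj F (orthoproj ip F (nu s)) + c *: vsproj F (orthoproj ip F (nu t)).
  by rewrite lfunE /= vsprojK ?mem_orthoproj // ec linearD linearZ.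
rewrite linearD linearZ /= wedgeDl wedgeZl linearD linearZ /=.
by rewrite wedge_in_sq scaler0 addr0.
Qed.

Lemma arrow_anti (S : {set 'I_n}) (s t : 'I_n) : s \in S -> t \in S -> s != t ->
  (arrow (S :\ s) (S :\ s :\ t) t \o arrow S (S :\ s) s)%VF =
  - (arrow (S :\ t) (S :\ s :\ t) s \o arrow S (S :\ t) t)%VF.
Proof.
move=> sS tS st; have eX : S :\ s :\ t = S :\ t :\ s by rewrite !setDDl setUC.
rewrite arrow_comp //= eX arrow_comp // 1?eq_sym //= -tmapNl; congr (tmap _ _).
apply/lfunP=> z; rewrite opp_lfunE !comp_lfunE !lfunE /=.
exact: wedge_in_anti.
Qed.

Lemma differential_in S (a : summand ip nu S) :
  differential ip nu (dsum_in _ S a) =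
  \sum_(s in S) dsum_in _ (S :\ s) (arrow S (S :\ s) s a).
Proof.
rewrite differentialE sum_lfunE (bigD1 S) //=.
rewrite [X in _ + X]big1 ?addr0 => [|X XS].
  rewrite sum_lfunE; apply: eq_bigr => s _; rewrite !comp_lfunE.
  by rewrite -[dsum_out _ _ _]comp_lfunE dsum_inK id_lfunE.
rewrite sum_lfunE big1 // => s _; rewrite !comp_lfunE.
rewrite -[dsum_out _ _ _]comp_lfunE dsum_in_out_neq 1?eq_sym //.
by rewrite zero_lfunE !linear0.
Qed.

Lemma differential_sq (f : chains ip nu) :
  differential ip nu (differential ip nu f) = 0.
Proof.
rewrite (dsum_expand f) !linear_sum big1 // => S _ /=.
move: (dsum_out _ S f) => a.
rewrite differential_in linear_sum /=.
pose F s t := if s == t then 0 else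
  dsum_in (summand ip nu) (S :\ s :\ t)
    ((arrow (S :\ s) (S :\ s :\ t) t \o arrow S (S :\ s) s)%VF a).
transitivity (\sum_(s in S) \sum_(t in S) F s t).
  apply: eq_bigr => s sS; rewrite differential_in [RHS](bigD1 s) //=.
  rewrite {1}/F eqxx add0r; apply: eq_big => t; first by rewrite !inE andbC.
  by rewrite !inE /F eq_sym comp_lfunE => /andP[/negPf->].
apply: sum_alternating => [s _|s t sS tS]; rewrite /F ?eqxx // eq_sym.
case: (eqVneq t s) => [_|ts]; first by rewrite oppr0.
rewrite arrow_anti 1?eq_sym // opp_lfunE linearN; congr (- _).
by have -> : S :\ s :\ t = S :\ t :\ s by rewrite !setDDl setUC.
Qed.

End Complex.

(** * Dimensions of flats and of spaces of relations *)

Section Dimensions.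
Variables (K : fieldType) (V : vectType K) (ip : {symmetric V}).
Variables (n : nat) (nu : 'I_n -> V).
Local Notation H := (flat ip nu).
Local Notation W := (relations_on nu).

Definition coord_space (S : {set 'I_n}) : {vspace 'rV[K]_n} :=
  <<[seq delta_mx 0%R s | s <- enum S]>>%VS.

Lemma mem_coord_space (S : {set 'I_n}) (w : 'rV[K]_n) :
  reflect (forall r, r \notin S -> w 0 r = 0) (w \in coord_space S).
Proof.
apply: (iffP idP) => [wS r rS|wS].
  suff /subvP/(_ w wS) : (coord_space S <= lker (linfun (@coord_fun K n r)))%VS.
    by rewrite memv_ker lfunE => /eqP.
  apply/span_subvP => _ /mapP[s sS ->].
  rewrite memv_ker lfunE /= /coord_fun mxE eqxx /=.
  rewrite (_ : r == s = false) //; apply: contraNF rS => /eqP->.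
  by rewrite -mem_enum.
rewrite (row_sum_delta w); apply: memv_suml => r _.
have [rS|/wS->] := boolP (r \in S); last by rewrite scale0r mem0v.
by apply/memvZ/memv_span/map_f; rewrite mem_enum.
Qed.

Lemma dim_coord_space S : \dim (coord_space S) = #|S|.
Proof.
rewrite cardE -(size_map (delta_mx 0 : 'I_n -> 'rV[K]_n)).
suff : free [seq delta_mx 0 s : 'rV[K]_n | s <- enum S] by move/eqP.
have : uniq (enum S) by apply: enum_uniq.
elim: (enum S) => [|s t IHt] /=; first by rewrite nil_free.
move=> /andP[st /IHt ft]; rewrite free_cons ft andbT; apply/negP => sin.
suff /subvP/(_ _ sin) :
  (<<[seq delta_mx 0%R r | r <- t]>> <= lker (linfun (@coord_fun K n s)))%VS.
  by rewrite memv_ker lfunE /= /coord_fun mxE !eqxx oner_eq0.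
apply/span_subvP => _ /mapP[r rt ->].
rewrite memv_ker lfunE /= /coord_fun mxE eqxx /=.
by rewrite (_ : s == r = false) //; apply: contraNF st => /eqP->.
Qed.

(** Rank-nullity for the relation map on the vectors supported in [S]: its kernel
    is [W_S], and the orthogonal of its image is [H_S]. *)
Lemma dim_flat_relations S : nondegenerate_on ip fullv ->
  (\dim (H S) + #|S| = \dim {:V} + \dim (W S))%N.
Proof.
move=> nd; pose N := <<[seq nu s | s <- enum S]>>%VS.
have relE s : relation_fun nu (delta_mx 0 s) = nu s.
  rewrite /relation_fun (bigD1 s) //= mxE !eqxx scale1r big1 ?addr0 // => r rs.
  by rewrite mxE (negPf rs) andbF scale0r.
have eN : (linfun (relation_fun nu) @: coord_space S = N)%VS.
  rewrite limg_span -map_comp; congr <<_>>%VS; apply: eq_map => s /=.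
  by rewrite lfunE /= relE.
have eW : (coord_space S :&: lker (linfun (relation_fun nu)) = W S)%VS.
  apply/vspaceP => w; rewrite memv_cap andbC.
  apply/andP/mem_relations_on.
    rewrite memv_ker lfunE => -[/eqP w0 /mem_coord_space wS].
    by split.
  move=> [w0 wS]; split; last exact/mem_coord_space.
  by rewrite memv_ker lfunE /= /relation_fun w0.
have eH : H S = orthov ip N.
  apply/vspaceP => v; rewrite mem_orthov_sym.
  apply/mem_flat/span_subvP => [vS _ /mapP[s sS ->]|vS s sS].
    by rewrite mem_orthov1 ip_sym vS // -mem_enum.
  by apply/eqP; rewrite ip_sym -mem_orthov1; apply/vS/map_f; rewrite mem_enum.
rewrite eH -(dim_orthov N nd) -(dim_coord_space S) -eW -eN.
rewrite -(limg_ker_dim (linfun (relation_fun nu)) (coord_space S)).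
by rewrite addnA addnAC.
Qed.

End Dimensions.


(** * The Euler characteristic *)

Lemma dim_subvs (K : fieldType) (V : vectType K) (U : {vspace V}) :
  \dim {:subvs_of U} = \dim U.
Proof. by rewrite dimvf. Qed.

Lemma sum_binomial (R : comNzRingType) (t : R) h m : (h <= m)%N ->
  \sum_(i < m.+1) t ^+ i * 'C(h, i)%:R = (1 + t) ^+ h.
Proof.
pose f (i : nat) := 1 ^+ (h - i) * t ^+ i *+ 'C(h, i).
move=> hm; rewrite exprDn (big_ord_widen _ f (_ : h < m.+1)%N) //.
rewrite [RHS]big_mkcond; apply: eq_bigr => i _.
rewrite /f expr1n mul1r mulr_natr ltnS; case: leqP => // hi.
by rewrite bin_small ?mulr0n.
Qed.

(** Here [h], [c] and [b] are the dimensions of the homology, of the chains and of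
    the boundaries of a complex; the last term is the boundary that leaves the
    range of summation. *)
Lemma sum_telescope (R : comNzRingType) (h c b : nat -> nat) m :
    (forall i, h i + b i + b i.+1 = c i)%N -> b 0%N = 0%N ->
  \sum_(i < m) (-1) ^+ i * (h i)%:R =
  \sum_(i < m) (-1) ^+ i * (c i)%:R + (-1) ^+ m * (b m)%:R :> R.
Proof.
move=> hbc b0; elim: m => [|m IHm]; first by rewrite !big_ord0 b0 mulr0 addr0.
rewrite !big_ord_recr /= IHm -hbc !natrD !mulrDr exprS mulN1r mulNr.
rewrite -!addrA; congr (_ + _); rewrite addrC.
by rewrite subrr addr0.
Qed.

Section Homology.
Variables (K : fieldType) (V : vectType K) (ip : {symmetric V}).
Variables (n : nat) (nu : 'I_n -> V).
Local Notation H := (flat ip nu).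
Local Notation W := (relations_on nu).
Local Notation d := (differential ip nu).
Local Notation C := (chains_deg ip nu).

Lemma dim_chains_deg a i j : \dim (C a i j) =
  (\sum_(S : {set 'I_n} | #|S| + i == a)
     'C(\dim (H S), i) * 'C(\dim (W S), j))%N.
Proof.
rewrite dim_dsum_sub [RHS]big_mkcond; apply: eq_bigr => S _.
case: ifP => _; last by rewrite dimv0.
by rewrite dim_tsub !dim_extpow !dim_subvs.
Qed.

Lemma limg_arrow S X s i j :
  (arrow ip nu S X s @:
       tsub (extpow (subvs_of (H S)) i) (extpow (subvs_of (W S)) j)
    <= tsub (extpow (subvs_of (H X)) i.+1) (extpow (subvs_of (W X)) j))%VS.
Proof.
apply: limg_tmap; last exact: ext_map_extpow.
rewrite limg_comp; apply: subv_trans (limgS _ (ext_map_extpow _ _)) _.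
apply/subvP => _ /memv_imgP[z zi ->]; rewrite lfunE /=.
exact: wedge_in_extpow.
Qed.

Lemma limg_differential a i j : (d @: C a i j <= C a i.+1 j)%VS.
Proof.
apply/subvP => _ /memv_imgP[f /mem_dsum_sub fC ->].
rewrite (dsum_expand f) linear_sum; apply: memv_suml => S _ /=.
rewrite differential_in; apply: memv_suml => s sS.
apply: dsum_in_sub; have := fC S.
rewrite [dsum_out _ _ _]lfunE /= /dsum_out_fun.
have eS : #|S| = #|S :\ s|.+1 by rewrite (cardsD1 s) sS.
rewrite eS addSnnS; case: ifP => _ fS.
  by apply: (subvP (limg_arrow _ _ _ _ _)); apply: memv_img.
by move: fS; rewrite memv0 => /eqP->; rewrite linear0 mem0v.
Qed.

Hypothesis d_sq : forall f, d (d f) = 0.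

(** Since the boundaries are cycles, this is rank-nullity for the differential on
    the chains of degree [(a, i, j)]. *)
Lemma dim_homology a i j :
  (\dim (homology ip nu a i j) + \dim (boundaries ip nu a i j)
     + \dim (boundaries ip nu a i.+1 j) = \dim (C a i j))%N.
Proof.
rewrite -(limg_ker_dim d (C a i j)); congr (_ + _)%N.
rewrite -[RHS](dimv_cap_compl _ (boundaries ip nu a i j)) addnC.
congr (_ + _)%N; congr (\dim _); apply/esym/capv_idPr.
case: i => [|i] /=; first exact: sub0v.
rewrite subv_cap limg_differential; apply/subvP => _ /memv_imgP[f _ ->].
by rewrite memv_ker d_sq.
Qed.

(** No flat has nonzero exterior powers beyond the dimension of [V]. *)
Lemma boundaries_top a j : boundaries ip nu a (\dim {:V}).+1 j = 0%VS.
Proof.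
apply/eqP; rewrite -subv0; apply: subv_trans (limg_differential _ _ _) _.
rewrite subv0 -dimv_eq0 dim_chains_deg big1 // => S _.
by rewrite bin_small // ltnS dimvS ?subvf.
Qed.

Lemma euler_char_flats (R : comNzRingType) (x y : R) :
  euler_char ip nu x y = \sum_(S : {set 'I_n})
    x ^+ #|S| * (1 - x) ^+ \dim (H S) * (1 + y) ^+ \dim (W S).
Proof.
pose k := \dim {:V}.
transitivity (\sum_(a < (n + k).+1) \sum_(i < k.+1) \sum_(j < n.+1)
    (-1) ^+ i * x ^+ a * y ^+ j * (\dim (C a i j))%:R).
  apply: eq_bigr => a _; rewrite exchange_big [RHS]exchange_big /=.
  apply: eq_bigr => j _.
  have := @sum_telescope R (fun i => \dim (homology ip nu a i j))
    (fun i => \dim (C a i j)) (fun i => \dim (boundaries ip nu a i j)) k.+1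
    (fun i => dim_homology a i j) (dimv0 _).
  rewrite boundaries_top dimv0 mulr0 addr0.
  move=> /(congr1 (fun z => x ^+ a * y ^+ j * z)).
  rewrite !mulr_sumr => e.
  apply: (etrans _ (etrans e _)); apply: eq_bigr => i _.
    by rewrite [RHS]mulrCA !mulrA.
  by rewrite mulrCA !mulrA.
transitivity (\sum_(i < k.+1) \sum_(j < n.+1) \sum_(S : {set 'I_n})
    (-1) ^+ i * x ^+ (#|S| + i) * y ^+ j *
      ('C(\dim (H S), i) * 'C(\dim (W S), j))%:R).
  rewrite exchange_big; apply: eq_bigr => i _.
  rewrite exchange_big; apply: eq_bigr => j _ /=.
  under eq_bigr => a _.
    rewrite dim_chains_deg natr_sum mulr_sumr big_mkcond /=.
    over.
  rewrite exchange_big; apply: eq_bigr => S _ /=.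
  (* Each [S] and [i] contribute to the single first degree [|S| + i]. *)
  have leS : (#|S| + i < (n + k).+1)%N.
    rewrite ltnS; apply: leq_add; last by rewrite -ltnS.
    by rewrite -[X in (_ <= X)%N]card_ord max_card.
  rewrite (bigD1 (Ordinal leS)) //= eqxx big1 ?addr0 // => a.
  by rewrite -val_eqE /= eq_sym => /negPf->.
under eq_bigr do rewrite exchange_big.
rewrite exchange_big; apply: eq_bigr => S _ /=.
have dimH : (\dim (H S) <= k)%N by rewrite dimvS ?subvf.
have dimW : (\dim (W S) <= n)%N.
  by rewrite (leq_trans (dimvS (subvf _))) // dimvf dim_matrix mul1r.
rewrite -(sum_binomial (- x) dimH) -(sum_binomial y dimW).
rewrite -mulrA mulr_suml mulr_sumr.
apply: eq_bigr => i _; rewrite !mulr_sumr; apply: eq_bigr => j _.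
rewrite natrM exprD [(- x) ^+ _]exprNn; ring.
Qed.

End Homology.

Theorem proposition2p5 (K : fieldType) (charK0 : [pchar K] =i pred0)
    (V : vectType K) (ip : {symmetric V}) (n : nat) (nu : 'I_n -> V)
    (flat_nondeg : forall (S : {set 'I_n}) (s : 'I_n), s \in S ->
       nondegenerate_on ip (flat ip nu (S :\ s)))
    (relations_nondeg : forall (S : {set 'I_n}) (s : 'I_n), s \in S ->
       nondegenerate_on (@std_ip K n) (relations_on nu (S :\ s)))
    (R : comUnitRingType) (x y : R) (xU : x \is a GRing.unit) :
  euler_char ip nu x y =
    (- x) ^+ \dim {:V} * tutte ip nu (- (1 / x)) (-1 - x - x * y).
Proof.
have d_sq := differential_sq flat_nondeg relations_nondeg.
rewrite (euler_char_flats d_sq) /tutte mulr_sumr; apply: eq_bigr => S _.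
have dimHW : (\dim (flat ip nu S) + #|S| =
              \dim {:V} + \dim (relations_on nu S))%N.
  (* Nonempty [S] make [V], the flat of [set s] minus [s], nondegenerate. *)
  have [->|[s sS]] := set_0Vmem S.
    have -> : flat ip nu set0 = fullv by rewrite /flat big_set0.
    suff -> : relations_on nu set0 = 0%VS by rewrite dimv0 cards0.
    apply/eqP; rewrite -subv0; apply/subvP => w /mem_relations_on[_ w0].
    by rewrite memv0; apply/eqP/rowP => r; rewrite w0 ?inE // mxE.
  apply: dim_flat_relations; have := flat_nondeg [set s] s (set11 s).
  by rewrite setDv /flat big_set0.
set h := \dim (flat ip nu S) in dimHW *.
set w := \dim (relations_on nu S) in dimHW *.
have hk : (h <= \dim {:V})%N by rewrite dimvS ?subvf.
have -> : #|S| = (\dim {:V} - h + w)%N.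
  by rewrite addnC addnBA // addnC -dimHW addKn.
have ek : (- x) ^+ \dim {:V} = (- x) ^+ (\dim {:V} - h) * (- x) ^+ h.
  by rewrite -exprD subnK.
have -> : 1 + (-1 - x - x * y) = - x * (1 + y).
  by rewrite !addrA addrN add0r mulrDr mulr1 mulNr.
have e1 : (- x) ^+ h * (1 + - (1 / x)) ^+ h = (1 - x) ^+ h.
  by rewrite -exprMn mulrDr mulr1 mulrNN div1r divrr // addrC.
have e2 m : x ^+ m = (-1) ^+ m * (- x) ^+ m by rewrite -exprMn mulN1r opprK.
rewrite -e1 e2 [(- x * _) ^+ _]exprMn ek [(- x) ^+ (_ + w)]exprD.
have reorder (p q r u v z : R) :
    u * (p * r) * (q * v) * z = p * q * (u * v * (r * z)) by ring.
exact: reorder.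
Qed.
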